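(* Let $k\geq 2$, $n\geq 1$ be integers. There exist $r=r(k)>0$ and a constant $C(k,n)<\infty$ such that for every tuple of exponents $\vec q=(q_\alpha:\alpha\in\{0,1\}^k)$ satisfying $|q_\alpha-p_k|\leq r$ for all $\alpha\in\{0,1\}^k$ and $\sum_{\alpha\in\{0,1\}^k}q_\alpha^{-1}=k+1$, and for every tuple $(f_\alpha:\alpha\in\{0,1\}^k)$ of measurable functions $f_\alpha:\mathbb{R}^n\to\mathbb{C}$ with $f_\alpha\in L^{q_\alpha}(\mathbb{R}^n)$, $$|\mathcal{T}_k(f_\alpha:\alpha\in\{0,1\}^k)|\leq C(k,n)\prod_{\alpha\in\{0,1\}^k}\|f_\alpha\|_{q_\alpha}.$$
   Context: $p_k=2^k/(k+1)$. For measurable $f_\alpha:\mathbb{R}^n\to\mathbb{C}$, $\alpha\in\{0,1\}^k$, the Gowers inner product is $\mathcal{T}_k(f_\alpha:\alpha\in\{0,1\}^k)=\int_{\mathbb{R}^{(k+1)n}}\prod_{\alpha\in\{0,1\}^k}\mathcal{C}^{\omega_\alpha}f_\alpha(x+\alpha\cdot\vec h)\,dx\,d\vec h$, where $x\in\mathbb{R}^n$, $\vec h=(h_1,\dots,h_k)\in(\mathbb{R}^n)^k$, $\alpha\cdot\vec h=\sum_{i=1}^k\alpha_ih_i$, $\mathcal{C}f=\bar f$, and $\omega_\alpha$ is the parity of the number of ones in $\alpha$. *)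

(* Defs.v *)
From HB Require Import structures.
From mathcomp Require Import all_boot all_order all_algebra.
From mathcomp Require Import all_classical all_reals all_analysis.
From mathcomp Require Import complex.

Set Implicit Arguments.
Unset Strict Implicit.
Unset Printing Implicit Defensive.
Import Order.TTheory GRing.Theory Num.Theory.

Local Open Scope classical_set_scope.
Local Open Scope ring_scope.
Local Open Scope complex_scope.

Section power_measure_step.
Context {d} {T : measurableType d} {R : realType} {n : nat}.
Variables (mu : {sigma_finite_measure set T -> \bar R})
  (nu : {sigma_finite_measure set (n.-tuple T) -> \bar R}).

Definition tuple_of_pair (u : T * n.-tuple T) : n.+1.-tuple T :=
  [the n.+1.-tuple T of u.1 :: u.2].

Lemma measurable_tuple_of_pair : measurable_fun [set: _] tuple_of_pair.
Proof. exact: measurable_cons. Qed.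

Definition product_tuple_measure : set (n.+1.-tuple T) -> \bar R :=
  pushforward (mu \x nu)%E tuple_of_pair.

Let ptm0 : product_tuple_measure set0 = 0%E.
Proof. by rewrite /product_tuple_measure /pushforward preimage_set0 measure0. Qed.

Let ptm_ge0 A : (0 <= product_tuple_measure A)%E.
Proof. exact: (measure_ge0 (mu \x nu)%E). Qed.

Let ptm_sigma_additive : semi_sigma_additive product_tuple_measure.
Proof.
exact: (@measure_semi_sigma_additive _ _ _
  (measure_function_pushforward__canonical__measure_function_Measure
     (mu \x nu)%E measurable_tuple_of_pair)).
Qed.

HB.instance Definition _ := isMeasure.Build _ _ _ product_tuple_measure
  ptm0 ptm_ge0 ptm_sigma_additive.

Let ptm_sigma_finite : sigma_finite [set: _] product_tuple_measure.
Proof.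
have /sigma_finiteP[F [FT ndF Foo]] := sigma_finiteT mu.
have /sigma_finiteP[G [GT ndG Goo]] := sigma_finiteT nu.
pose g (t : n.+1.-tuple T) : T * n.-tuple T := (thead t, [tuple of behead t]).
have mg : measurable_fun [set: _] g.
  apply: measurable_fun_pair; first exact: measurable_tnth.
  exact: measurable_behead.
have gK : cancel tuple_of_pair g.
  move=> [x t]; rewrite /g /tuple_of_pair /= theadE.
  by congr pair; exact/val_inj.
exists (fun i => g @^-1` (F i `*` G i)).
  rewrite -preimage_bigcup -[LHS](preimage_setT g); congr (g @^-1` _).
  rewrite predeqE => -[x t]; split => // _.
  have [i _ Fix] : (\bigcup_i F i) x by rewrite -FT.
  have [j _ Gjt] : (\bigcup_i G i) t by rewrite -GT.
  exists (maxn i j) => //; split => /=.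
    by move: x Fix; exact/subsetPset/ndF/leq_maxl.
  by move: t Gjt; exact/subsetPset/ndG/leq_maxr.
move=> i; have [mF Fi] := Foo i; have [mG Gi] := Goo i; split.
  by rewrite -[X in measurable X]setTI; apply: mg => //; exact: measurableX.
rewrite /product_tuple_measure /pushforward -comp_preimage.
rewrite (_ : g \o tuple_of_pair = id); last by apply/funext => u; exact: gK.
by rewrite preimage_id product_measure1E// lte_mul_pinfty// ge0_fin_numE.
Qed.

HB.instance Definition _ := Measure_isSigmaFinite.Build _ _ _
  product_tuple_measure ptm_sigma_finite.

End power_measure_step.

(* The n-fold product mu x ... x mu; for n = 0 it is the unit mass at the
   empty tuple. *)
Fixpoint power_measure {d} {T : measurableType d} {R : realType}
    (mu : {sigma_finite_measure set T -> \bar R}) (n : nat) :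
    {sigma_finite_measure set (n.-tuple T) -> \bar R} :=
  if n isn't n'.+1 then \d_[tuple]
  else product_tuple_measure mu (power_measure mu n').

Section lebesgue_Rn.
Variables (R : realType) (n : nat).

Definition borel_lebesgue_Rn :
    {sigma_finite_measure set (n.-tuple (measurableTypeR R)) -> \bar R} :=
  power_measure lebesgue_measure n.

(* Lebesgue measure on R^n. The underlying sigma-algebra is the completed one
   (Caratheodory-measurable sets), so that measurability is Lebesgue, not
   Borel, measurability. *)
Definition lebesgue_Rn := @completed_measure_extension _ _ _ borel_lebesgue_Rn.
HB.instance Definition _ := Measure.on lebesgue_Rn.

(* Lebesgue measure on R^(m n) seen as (R^n)^m, again completed. *)
Definition lebesgue_Rn_pow (m : nat) :=
  @completed_measure_extension _ _ _ (power_measure borel_lebesgue_Rn m).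
Arguments lebesgue_Rn_pow : clear implicits.
HB.instance Definition _ (m : nat) := Measure.on (lebesgue_Rn_pow m).

End lebesgue_Rn.
Arguments lebesgue_Rn : clear implicits.
Arguments lebesgue_Rn_pow : clear implicits.

Section complex_valued.
Context {d} {T : measurableType d} {R : realType}.
Implicit Types (mu : {measure set T -> \bar R}) (f : T -> R[i]).

(* mu only serves to determine the sigma-algebra on T. *)
Definition cmeasurable mu f :=
  measurable_fun [set: T] (fun x => complex.Re (f x)) /\
  measurable_fun [set: T] (fun x => complex.Im (f x)).

Definition cintegrable mu f :=
  mu.-integrable [set: T] (fun x => (complex.Re (f x))%:E) /\
  mu.-integrable [set: T] (fun x => (complex.Im (f x))%:E).

(* Meaningful under cintegrable only (fine sends infinite values to 0). *)
Definition cintegral mu f : R[i] :=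
  (\int[mu]_x complex.Re (f x)) +i* (\int[mu]_x complex.Im (f x)).

Definition cLnorm mu (q : R) f : \bar R :=
  'N[mu]_(q%:E)[(fun x => (Normc.normc (f x))%:E)]%E.

End complex_valued.

Section gowers.
Context {R : realType} {k n : nat}.
Implicit Types (a : k.-tuple bool) (x : n.-tuple R) (h : k.-tuple (n.-tuple R)).

Definition cube_shift a x h : n.-tuple R :=
  [tuple tnth x i + \sum_(j < k | tnth a j) tnth (tnth h j) i | i < n].

(* C^(omega_a) *)
Definition conj_parity a (z : R[i]) : R[i] :=
  if odd (count id a) then conjc z else z.

(* v = (x, h_1, ..., h_k) *)
Definition gowers_integrand (f : k.-tuple bool -> n.-tuple R -> R[i])
    (v : k.+1.-tuple (n.-tuple R)) : R[i] :=
  \prod_(a : k.-tuple bool)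
    conj_parity a (f a (cube_shift a (thead v) [tuple of behead v])).

Definition gowers_form (f : k.-tuple bool -> n.-tuple R -> R[i]) : R[i] :=
  cintegral (lebesgue_Rn_pow R n k.+1) (gowers_integrand f).

End gowers.

(* p_k, the exponent for which the k-th Gowers norm is controlled by L^(p_k). *)
Definition gowers_exponent (R : realType) (k : nat) : R :=
  2 ^+ k / k.+1%:R.

(* Main.v *)
Require Import Defs.
From HB Require Import structures.
From mathcomp Require Import all_boot all_order all_algebra.
From mathcomp Require Import all_classical all_reals all_analysis.
From mathcomp Require Import complex.
From mathcomp Require Import measurable_realfun ring lra.

(** The forms [L_a(x, h) = x + a.h] indexed by a "corner"
    [{a, b, a + e_l (l <> 0)}], [b] differing from [a] in coordinate [0], are
    related to [(x, h)] by a measure-preserving change of variables, so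
    [\int prod_(e in corner) g_e(L_e)] factors as [prod_e \int g_e].
    When the [1/q_e] are close to [(k+1)/2^k] and sum to [k+1], the vector
    [(1/q_e)] is a convex combination of the indicators of corners; weighted
    AM-GM applied to [g_e = |f_e|^q_e / ||f_e||^q_e] then bounds
    [prod_e |f_e(L_e)| / ||f_e||] by the same convex combination of corner
    products, each of integral at most [1]. *)

Set Implicit Arguments.
Unset Strict Implicit.
Unset Printing Implicit Defensive.
Import Order.TTheory GRing.Theory Num.Theory.

Local Open Scope classical_set_scope.
Local Open Scope ring_scope.

(** * Completed measures *)

(** Each corner gives an endpoint estimate, with exponent 1 on its vertices and infinity elsewhere;
    the pointwise AM-GM inequality takes the place of multilinear interpolation between these
    estimates. The weights are sought as functions of [b] alone, so that there are as many unknowns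
    as values [1/q_e]. At [1/q_e = (k+1)/2^k] the solution is the uniform weight on all corners; it
    is positive, hence the weights stay nonnegative in a neighbourhood, and this dictates [r]. The
    obstacle is measurability: the [f_e] are only Lebesgue measurable, while Tonelli is applied on
    uncompleted products. Composition with [L_e] must therefore be shown to preserve Lebesgue
    measurability, which uses that [L_e] pulls null sets back to null sets, and integrals along
    corners are bounded through Borel majorants, which suffices because only upper bounds are
    wanted. *)

Section completion.
Local Open Scope ereal_scope.
Context d (T : measurableType d) (R : realType).
Variable mu : {sigma_finite_measure set T -> \bar R}.

Local Notation cmu := (@completed_measure_extension _ _ _ mu).
Local Notation cT := (caratheodory_type (mu_ext mu)).

Lemma completed_measurable (A : set T) :
  measurable A -> measurable (A : set cT).
Proof. by move=> mA; apply: sub_caratheodory; exact: sub_sigma_algebra. Qed.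

Lemma completed_measureE (A : set T) : measurable A -> cmu A = mu A.
Proof. exact: measurable_mu_extE. Qed.

Lemma measurable_completed_id :
  measurable_fun [set: cT] (idfun : cT -> T).
Proof.
by move=> _ A mA; rewrite setTI preimage_id; exact: completed_measurable.
Qed.

Lemma measurable_fun_completed d' (T' : measurableType d') (f : T -> T') :
  measurable_fun [set: T] f -> measurable_fun [set: cT] (f : cT -> T').
Proof.
by move=> mf; exact: (measurableT_comp mf measurable_completed_id).
Qed.

(** The identity pushes the completed measure forward to [mu], since the two agree on the original
    sigma-algebra. *)
Lemma ge0_integral_completed (f : T -> \bar R) :
  measurable_fun [set: T] f -> (forall x, 0 <= f x) ->
  \int[cmu]_x f x = \int[mu]_x f x.
Proof.
move=> mf f0.
have := @ge0_integral_pushforward _ _ _ _ _ _ measurable_completed_id cmu setT f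
  measurableT mf (fun y _ => f0 y).
rewrite preimage_setT => <-.
apply: eq_measure_integral => [|m A mA _]; first exact: measurable_completed_id.
exact: completed_measureE.
Qed.

(** When the outer measure is finite, intersect countable covers whose total measure exceeds it by
    less than [1/(n+1)]; otherwise the whole space will do. *)
Lemma mu_ext_envelope (X : set T) :
  exists B, [/\ measurable B, X `<=` B & mu B = mu_ext mu X].
Proof.
have [Xoo|Xoo] := eqVneq (mu_ext mu X) +oo.
  exists setT; split => //; rewrite Xoo; apply/eqP; rewrite -leye_eq -Xoo.
  by rewrite -measurable_mu_extE//; exact: le_outer_measure.
have Xfin : mu_ext mu X \is a fin_num.
  by rewrite ge0_fin_numE ?ltey// mu_ext_ge0.
have cov (n : nat) : exists A : (set T)^nat, measurable_cover X A /\
    \sum_(0 <= k <oo) mu (A k) < mu_ext mu X + n.+1%:R^-1%:E.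
  have n0 : (0 < n.+1%:R^-1 :> R)%R by rewrite invr_gt0.
  have [_ [/= A XA <-] ?] := lb_ereal_inf_adherent n0 Xfin.
  by exists A.
have /choice[A HA] := cov.
have mA n k : measurable (A n k) by have [[]] := HA n.
have mU n : measurable (\bigcup_k A n k) by exact: bigcupT_measurable.
have mF : measurable (\bigcap_n \bigcup_k A n k).
  by apply: bigcapT_measurable.
have XF : X `<=` \bigcap_n \bigcup_k A n k.
  by apply: sub_bigcap => n _; have [[]] := HA n.
exists (\bigcap_n \bigcup_k A n k); split => //.
apply/eqP; rewrite eq_le; apply/andP; split; last first.
  by rewrite -(measurable_mu_extE mu mF); exact: le_outer_measure.
apply/lee_addgt0Pr => _/posnumP[e]; near \oo => n.
apply: (@le_trans _ _ (mu (\bigcup_k A n k))).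
  by apply: le_measure; rewrite ?inE//; exact: bigcap_inf.
apply: (@le_trans _ _ (\sum_(0 <= k <oo) mu (A n k))).
  by apply: measure_sigma_subadditive.
have [_ /ltW/le_trans] := HA n; apply.
rewrite leeD// lee_fin ltW//.
by near: n; apply: near_infty_natSinv_lt.
Unshelve. all: by end_near. Qed.

Lemma completed_null (N M : set T) : measurable M -> mu M = 0 -> N `<=` M ->
  measurable (N : set cT) /\ cmu N = 0.
Proof.
move=> mM M0 NM; split.
  apply: measure_is_complete_caratheodory; exists M; split => //.
    exact: completed_measurable.
  by rewrite /= measurable_mu_extE.
apply/eqP; rewrite eq_le measure_ge0 andbT -M0 -(completed_measureE mM).
exact: le_outer_measure.
Qed.

(** Envelopes are taken twice. Cutting [A] by sets of finite measure makes the excess of its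
    envelope null, by subtraction of finite measures; an envelope of that excess is then a null set
    of the original sigma-algebra. Countable unions reassemble the pieces. *)
Lemma completed_envelope (A : set cT) : measurable A ->
  exists B M : set T, [/\ measurable B, measurable M, mu M = 0,
    A `<=` B & B `\` A `<=` M].
Proof.
move=> mA.
have /sigma_finiteP[F [FT ndF Foo]] := sigma_finiteT mu.
have mFc i : measurable (F i : set cT).
  by apply: completed_measurable; exact: (Foo i).1.
have mAF i : measurable (A `&` F i : set cT) by exact: measurableI.
have E i : exists B : set T, [/\ measurable B, A `&` F i `<=` B & cmu (B `\` (A `&` F i)) = 0].
  have [B [mB AB Beq]] := mu_ext_envelope (A `&` F i).
  have AFoo : cmu (A `&` F i) < +oo.
    apply: (@le_lt_trans _ _ (cmu (F i))).
      by apply: le_outer_measure; exact: subIsetr.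
    by rewrite completed_measureE ?(Foo i).2//; exact: (Foo i).1.
  exists B; split => //.
  rewrite measureD//=; last 2 first.
  - exact: completed_measurable.
  - rewrite [X in X < _](completed_measureE mB) Beq; exact: AFoo.
  rewrite setIidr// [X in X - _](completed_measureE mB) Beq.
  by rewrite subee// ge0_fin_numE ?mu_ext_ge0//; exact: AFoo.
have /choice[B HB] := E.
have HM i : exists M : set T, [/\ measurable M, B i `\` (A `&` F i) `<=` M & mu M = 0].
  have [M [mM BM M0]] := mu_ext_envelope (B i `\` (A `&` F i)).
  by exists M; split => //; rewrite M0; have [] := HB i.
have /choice[M HM'] := HM.
have mB i : measurable (B i) by have [] := HB i.
have mM i : measurable (M i) by have [] := HM' i.
exists (\bigcup_i B i), (\bigcup_i M i); split.
- exact: bigcupT_measurable.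
- exact: bigcupT_measurable.
- have : mu.-negligible (\bigcup_i M i).
    by apply: negligible_bigcup => i; apply/negligibleP => //; have [] := HM' i.
  by move/negligibleP => -> //; exact: bigcupT_measurable.
- move=> x Ax; have [i _ Fix] : (\bigcup_i F i) x by rewrite -FT.
  by exists i => //; have [_ AB _] := HB i; apply: AB.
- move=> x [[i _ Bix] nAx]; exists i => //; have [_ BM _] := HM' i.
  by apply: BM; split => // -[].
Qed.

(* The majorant is the supremum over rationals q of q on a Borel envelope of
   {f > q}; it differs from f on a null set only. *)
Lemma completed_majorant (f : cT -> R) : measurable_fun [set: cT] f ->
  (forall x, (0 <= f x)%R) ->
  exists g : T -> \bar R, [/\ measurable_fun [set: T] g,
    (forall x, (f x)%:E <= g x) & \int[mu]_x g x = \int[cmu]_x (f x)%:E].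
Proof.
move=> mf f0.
(* An index that codes no rational gets the default 0, which merely repeats a rational level. *)
pose q (n : nat) : R := ratr (odflt 0%R (unpickle n : option rat)).
have mq n : measurable (f @^-1` `]q n, +oo[ : set cT).
  by rewrite -[X in measurable X]setTI; exact: mf.
have E n : exists BM : set T * set T, [/\ measurable BM.1, measurable BM.2, mu BM.2 = 0,
    f @^-1` `]q n, +oo[ `<=` BM.1 & BM.1 `\` (f @^-1` `]q n, +oo[) `<=` BM.2].
  by have [B [M H]] := completed_envelope (mq n); exists (B, M).
have /choice[BM H] := E.
pose h n (x : T) : \bar R := if x \in (BM n).1 then (q n)%:E else -oo.
pose g x : \bar R := ereal_sup (range (h ^~ x)).
have mh n : measurable_fun [set: T] (h n).
  apply: measurable_fun_ifT => //=; apply: (measurable_fun_bool true).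
  rewrite setTI (_ : _ @^-1` _ = (BM n).1); first by have [] := H n.
  by apply/seteqP; split => x /= => [/set_mem|/mem_set].
have mg : measurable_fun [set: T] g.
  rewrite (_ : g = fun x => esups (h ^~ x) 0%N).
    exact: measurable_fun_esups.
  apply/funext => x; rewrite /esups/= /sdrop; congr (ereal_sup _).
  by apply/seteqP; split => _ [n _ <-]; exists n.
have fg x : (f x)%:E <= g x.
  apply/lee_subgt0Pr => e e0.
  have : (f x - e < f x)%R by rewrite ltrBlDr ltrDl.
  move=> /rat_in_itvoo[r]; rewrite in_itv/= => /andP[er rf].
  pose n : nat := pickle r.
  have qn : q n = ratr r by rewrite /q pickleK.
  apply: (@le_trans _ _ (q n)%:E).
    by rewrite -EFinB lee_fin qn; exact: ltW.
  apply: ereal_sup_ubound; exists n => //; rewrite /h ifT//; apply/mem_set.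
  have [_ _ _ + _] := H n; apply.
  by rewrite /= in_itv/= andbT qn.
exists g; split => //.
rewrite -ge0_integral_completed//; last first.
  by move=> x; rewrite (le_trans _ (fg x))// lee_fin.
apply: ge0_ae_eq_integral; first exact: measurableT.
- exact: measurable_fun_completed.
- exact/measurable_EFinP.
- by move=> x _; rewrite (le_trans _ (fg x))// lee_fin.
- by move=> x _; rewrite lee_fin.
have : mu.-negligible (\bigcup_n (BM n).2).
  by apply: negligible_bigcup => n; apply/negligibleP => //; have [] := H n.
have mM : measurable (\bigcup_n (BM n).2).
  by apply: bigcupT_measurable => n; have [] := H n.
move=> /negligibleP => /(_ mM) M0.
exists (\bigcup_n (BM n).2); split => //.
- exact: completed_measurable.
- by rewrite /= completed_measureE.
(* If [f x < g x], some level [q n] exceeds [f x] although [x] lies in the envelope of [{f > q n}];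
   such an [x] belongs to the null set attached to [n]. *)
move=> x /= gf; apply: contrapT => nM; apply: gf => _.
apply/eqP; rewrite eq_le fg andbT.
apply: ge_ereal_sup => _ [n _ <-]; rewrite /h.
case: ifPn => [|_]; last by rewrite leNye.
rewrite inE => Bx; rewrite lee_fin leNgt; apply/negP => qf.
apply: nM; exists n => //; have [_ _ _ _ BMn] := H n.
apply: BMn; split => //=; rewrite in_itv/= andbT => /lt_trans/(_ qf).
by rewrite ltxx.
Qed.
End completion.

(** A completed-measurable set is a measurable set minus a part of a null set. Measurability of [L]
    handles the former, and the assumption on null sets makes the preimage of the latter
    negligible. *)
Lemma measurable_completed_map d1 d2 (T1 : measurableType d1)
    (T2 : measurableType d2) (R : realType)
    (mu1 : {sigma_finite_measure set T1 -> \bar R})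
    (mu2 : {sigma_finite_measure set T2 -> \bar R}) (L : T1 -> T2) :
  measurable_fun [set: T1] L ->
  (forall M, measurable M -> mu2 M = 0%E -> mu1 (L @^-1` M) = 0%E) ->
  measurable_fun [set: caratheodory_type (mu_ext mu1)]
    (L : caratheodory_type (mu_ext mu1) -> caratheodory_type (mu_ext mu2)).
Proof.
move=> mL L0 _ A mA; rewrite setTI.
have [B [M [mB mM M0 AB BAM]]] := completed_envelope mA.
have -> : L @^-1` A = L @^-1` B `\` L @^-1` (B `\` A).
  apply/seteqP; split=> [x Ax|x [Bx nBA]] /=.
    by split; [exact: AB|case].
  by apply: contrapT => nA; apply: nBA.
have mLp C : measurable C -> measurable (L @^-1` C).
  by move=> mC; rewrite -[X in measurable X]setTI; exact: mL.
apply: measurableD; first exact/completed_measurable/mLp.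
have [] := @completed_null _ _ _ mu1 (L @^-1` (B `\` A)) (L @^-1` M) => //.
- exact: mLp.
- exact: L0.
- by move=> x; exact: BAM.
Qed.

(** * Integration over powers of a measure *)

Section power_measure_integral.
Local Open Scope ereal_scope.
Context d (T : measurableType d) (R : realType).
Variable mu : {sigma_finite_measure set T -> \bar R}.

Lemma ge0_integral_power_measure0 (F : 0.-tuple T -> \bar R) :
  measurable_fun [set: 0.-tuple T] F ->
  \int[power_measure mu 0]_t F t = F [tuple].
Proof.
by move=> mF; rewrite integral_dirac// diracT mul1e.
Qed.

Variables (n : nat) (F : n.+1.-tuple T -> \bar R).
Hypotheses (mF : measurable_fun [set: n.+1.-tuple T] F) (F0 : forall t, 0 <= F t).

Let mG : measurable_fun [set: T * n.-tuple T] (F \o @tuple_of_pair _ _ n).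
Proof. exact: (measurableT_comp mF (@measurable_tuple_of_pair _ _ _)). Qed.

Let ge0_integral_power_measure_prod :
  \int[power_measure mu n.+1]_t F t =
  \int[mu \x power_measure mu n]_u F (tuple_of_pair u).
Proof.
have := @ge0_integral_pushforward _ _ _ _ _ _ (@measurable_tuple_of_pair _ _ n)
  (mu \x power_measure mu n) setT F measurableT mF (fun y _ => F0 y).
rewrite preimage_setT => <-.
apply: eq_measure_integral => [|m A mA _]; first exact: measurable_tuple_of_pair.
by [].
Qed.

Lemma measurable_integral_cons :
  measurable_fun [set: T] (fun x => \int[power_measure mu n]_t F (cons_tuple x t)).
Proof.
apply: (@measurable_fun_fubini_tonelli_F _ _ _ _ _ (power_measure mu n)
  (F \o @tuple_of_pair _ _ n)) => [|x].
all: by [exact: mG|exact: F0].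
Qed.

Lemma ge0_integral_power_measureS :
  \int[power_measure mu n.+1]_t F t =
  \int[mu]_x \int[power_measure mu n]_t F (cons_tuple x t).
Proof.
rewrite ge0_integral_power_measure_prod (fubini_tonelli1 (F \o @tuple_of_pair _ _ n)).
- by [].
- exact: mG.
- by move=> x; exact: F0.
Qed.

(** With the head variable innermost, it can be translated by an amount depending on all the
    others. *)
Lemma ge0_integral_power_measureS_swap :
  \int[power_measure mu n.+1]_t F t =
  \int[power_measure mu n]_t \int[mu]_x F (cons_tuple x t).
Proof.
rewrite ge0_integral_power_measure_prod (fubini_tonelli2 (F \o @tuple_of_pair _ _ n)).
- by [].
- exact: mG.
- by move=> x; exact: F0.
Qed.

End power_measure_integral.

(** * Invariance of Lebesgue measure under translations and reflections *)

Section lebesgue_translation.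
Local Open Scope ereal_scope.
Context (R : realType).
Notation leb := (@lebesgue_measure R).

Lemma lebesgue_measure_shift (c : R) (A : set R) : measurable A ->
  pushforward leb (+%R c : _ -> measurableTypeR R) A = leb A.
Proof.
move=> mA.
have mc : measurable_fun [set: measurableTypeR R]
  (+%R c : measurableTypeR R -> measurableTypeR R).
  exact: measurable_funD.
apply/esym/lebesgue_measure_unique => //= _ [[a b]] _ <-.
have E : (+%R c) @^-1` `]a, b] = `](a - c)%R, (b - c)%R]%classic.
  by apply/seteqP; split=> x /=; rewrite !in_itv/= ltrBlDl lerBrDl.
rewrite /pushforward E.
rewrite !lebesgue_measure_itv/= !lte_fin ltrD2r.
by rewrite -!EFinB opprB addrA subrK.
Qed.

Lemma ge0_integral_shift_sign (s : bool) (c : R) (f : measurableTypeR R -> \bar R) :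
  measurable_fun [set: measurableTypeR R] f -> (forall x, 0 <= f x) ->
  \int[leb]_x f (c + (-1) ^+ s * x)%R = \int[leb]_x f x.
Proof.
move=> mf f0.
have mc : measurable_fun [set: measurableTypeR R]
  (+%R c : measurableTypeR R -> measurableTypeR R).
  exact: measurable_funD.
have mN : measurable_fun [set: measurableTypeR R]
  (-%R : measurableTypeR R -> measurableTypeR R).
  exact: oppr_measurable.
transitivity (\int[leb]_x f (c + x)%R).
  case: s => /=; last by under eq_integral do rewrite expr0 mul1r.
  under eq_integral do rewrite expr1 mulN1r.
  have mfc : measurable_fun [set: measurableTypeR R] (f \o +%R c).
    exact: measurableT_comp.
  have := @ge0_integral_pushforward _ _ _ _ _ _ mN leb setT _
    measurableT mfc (fun y _ => f0 _).
  rewrite preimage_setT /comp => <-.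
  by apply: eq_measure_integral => // A mA _; exact: lebesgue_measureN.
have := @ge0_integral_pushforward _ _ _ _ _ _ mc leb setT _
  measurableT mf (fun y _ => f0 _).
rewrite preimage_setT /comp => <-.
by apply: eq_measure_integral => // A mA _; exact: lebesgue_measure_shift.
Qed.
End lebesgue_translation.

Section Rn.
Local Open Scope ereal_scope.
Context (R : realType).
Notation V n := (n.-tuple (measurableTypeR R)).
Notation leb n := (@borel_lebesgue_Rn R n).

(** The sign is a bit of a vertex: flipping coordinate [l] of [a] adds [h_l] to [x + a.h] if the bit
    is 0 and subtracts it if the bit is 1. *)
Definition signed_shift n (s : bool) (c t : n.-tuple R) : n.-tuple R :=
  [tuple (tnth c i + (-1) ^+ s * tnth t i)%R | i < n].

Lemma measurable_signed_shift d (X : measurableType d) n s (c t : X -> V n) :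
  measurable_fun setT c -> measurable_fun setT t ->
  measurable_fun [set: X] (fun x => signed_shift s (c x) (t x) : V n).
Proof.
move=> mc mt; apply/measurable_fun_tnthP => i.
rewrite (_ : _ \o _ = fun x => tnth (c x) i + (-1) ^+ s * tnth (t x) i)%R; last first.
  by apply/funext => x /=; rewrite tnth_mktuple.
apply: measurable_funD; first exact: (measurableT_comp (measurable_tnth i) mc).
apply: measurable_funM => //; exact: (measurableT_comp (measurable_tnth i) mt).
Qed.

Lemma signed_shift_cons n s (c : n.+1.-tuple R) x (t : n.-tuple R) :
  signed_shift s c (cons_tuple x t) =
  cons_tuple (thead c + (-1) ^+ s * x)%R (signed_shift s [tuple of behead c] t).
Proof.
apply: eq_from_tnth => i; rewrite tnth_mktuple.
case: (unliftP ord0 i) => [j ->|->]; last by rewrite !tnth0.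
rewrite !tnthS tnth_mktuple tnth_behead; congr (tnth c _ + _)%R; apply/val_inj => /=.
by rewrite inordK// ltnS; exact: (ltn_ord j).
Qed.

Lemma ge0_integral_signed_shift n s (c : V n) (f : V n -> \bar R) :
  measurable_fun [set: V n] f -> (forall x, 0 <= f x) ->
  \int[leb n]_x f (signed_shift s c x) = \int[leb n]_x f x.
Proof.
elim: n c f => [|n IH] c f mf f0.
  by apply: eq_integral => x _; rewrite [signed_shift _ _ _]tuple0 [x]tuple0.
have mfs : measurable_fun setT (fun x : V n.+1 => f (signed_shift s c x)).
  by apply: (measurableT_comp mf); exact: measurable_signed_shift.
rewrite !ge0_integral_power_measureS//.
have mfc x : measurable_fun setT (fun t : V n => f (cons_tuple x t)).
  by apply: (measurableT_comp mf); exact: measurable_cons.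
pose G (x : measurableTypeR R) : \bar R := \int[leb n]_t f (cons_tuple x t).
transitivity (\int[@lebesgue_measure R]_x G (thead c + (-1) ^+ s * x)%R).
  apply: eq_integral => x _; rewrite /G.
  rewrite -(IH [tuple of behead c] (fun t : V n =>
    f (@cons_tuple n (measurableTypeR R) (thead c + (-1) ^+ s * x)%R t)))//.
  by apply: eq_integral => t _; rewrite signed_shift_cons.
rewrite (ge0_integral_shift_sign s (thead c) (f := G))//.
- exact: measurable_integral_cons.
- by move=> x; apply: integral_ge0.
Qed.
End Rn.

(** * Integrals of products along corners of the cube *)

Lemma tnth_cons_tupleS (T : Type) n (x : T) (t : n.-tuple T) (i : 'I_n) :
  tnth (cons_tuple x t) (lift ord0 i) = tnth t i.
Proof. exact: tnthS. Qed.

Lemma behead_cons_tuple (T : Type) n (x : T) (t : n.-tuple T) :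
  [tuple of behead (cons_tuple x t)] = t.
Proof. exact/val_inj. Qed.

Definition flip_coord k (a : k.-tuple bool) (l : 'I_k) : k.-tuple bool :=
  [tuple tnth a i (+) (i == l) | i < k].

Lemma tnth_flip_coord k (a : k.-tuple bool) (l i : 'I_k) :
  tnth (flip_coord a l) i = tnth a i (+) (i == l).
Proof. by rewrite tnth_mktuple. Qed.

Lemma sum_flip_coord (R : pzRingType) k (a : k.-tuple bool) (l : 'I_k) (F : 'I_k -> R) :
  \sum_(j | tnth (flip_coord a l) j) F j =
  \sum_(j | tnth a j) F j + (-1) ^+ tnth a l * F l.
Proof.
rewrite [LHS]big_mkcond [in RHS]big_mkcond (bigD1 l)//= [in RHS](bigD1 l)//=.
rewrite tnth_flip_coord eqxx addbT.
under eq_bigr => j jl do rewrite tnth_flip_coord (negbTE jl) addbF.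
case: (tnth a l) => /=; last by rewrite expr0 mul1r add0r addrC.
by rewrite expr1 mulN1r add0r addrAC addrN add0r.
Qed.

Section gowers_integral.
Local Open Scope ereal_scope.
Context (R : realType) (n : nat).
Notation V := (n.-tuple (measurableTypeR R)).
Notation leb := (@borel_lebesgue_Rn R n).
Notation P m := (power_measure leb m).

Lemma emeasurable_prod d (T : measurableType d) (I : Type) (s : seq I)
    (g : I -> T -> \bar R) :
  (forall i, measurable_fun [set: T] (g i)) ->
  measurable_fun [set: T] (fun x => \prod_(i <- s) g i x).
Proof.
move=> mg; elim: s => [|i s IH].
  under eq_fun do rewrite big_nil.
  exact: measurable_cst.
under eq_fun do rewrite big_cons.
exact: emeasurable_funM.
Qed.

Lemma measurable_cube_shift d (T : measurableType d) k (a : k.-tuple bool)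
    (x : T -> V) (h : T -> k.-tuple V) :
  measurable_fun setT x -> measurable_fun setT h ->
  measurable_fun [set: T] (fun u => cube_shift a (x u) (h u) : V).
Proof.
move=> mx mh; apply/measurable_fun_tnthP => i.
rewrite (_ : _ \o _ = fun u => tnth (x u) i +
  \sum_(j < k) if tnth a j then tnth (tnth (h u) j) i else 0)%R; last first.
  by apply/funext => u /=; rewrite tnth_mktuple big_mkcond.
apply: measurable_funD; first exact: (measurableT_comp (measurable_tnth i) mx).
apply: measurable_sum => j; case: (tnth a j) => //.
apply: (measurableT_comp (measurable_tnth i)).
exact: (measurableT_comp (measurable_tnth j) mh).
Qed.

Lemma measurable_cube_shift_tuple k (a : k.-tuple bool) :
  measurable_fun [set: k.+1.-tuple V]
    (fun v => cube_shift a (thead v) [tuple of behead v] : V).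
Proof.
by apply: measurable_cube_shift; [exact: measurable_tnth|exact: measurable_behead].
Qed.

(** Each variable [h_l] occurs in a single factor, so the integral splits, and every factor is
    invariant under its own signed translation. *)
Lemma ge0_integral_prod_signed_shift m (c : V) (s : 'I_m -> bool)
    (g : 'I_m -> V -> \bar R) :
  (forall l, measurable_fun [set: V] (g l)) -> (forall l x, 0 <= g l x) ->
  \int[P m]_h (\prod_(l < m) g l (signed_shift (s l) c (tnth h l))) =
  \prod_(l < m) \int[leb]_x g l x.
Proof.
elim: m s g => [|m IH] s g mg g0.
  rewrite big_ord0; under eq_integral do rewrite big_ord0.
  by rewrite ge0_integral_power_measure0.
have mgs l : measurable_fun [set: m.+1.-tuple V]
    (fun h => g l (signed_shift (s l) c (tnth h l))).
  apply: (measurableT_comp (mg l)); apply: measurable_signed_shift => //.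
  exact: measurable_tnth.
rewrite ge0_integral_power_measureS; last 2 first.
- exact: emeasurable_prod.
- by move=> t; apply: prode_ge0.
transitivity (\int[leb]_x (g ord0 (signed_shift (s ord0) c x) *
    \prod_(l < m) \int[leb]_y g (lift ord0 l) y)).
  apply: eq_integral => x _.
  rewrite -(IH (s \o lift ord0) (g \o lift ord0))//=.
  rewrite -ge0_integralZl//.
  - apply: eq_integral => t _; rewrite big_ord_recl tnth0.
    congr (_ * _); apply: eq_bigr => l _; congr (g _ (signed_shift _ _ _)).
    exact: tnth_cons_tupleS.
  - apply: emeasurable_prod => l /=; apply: (measurableT_comp (mg _)).
    by apply: measurable_signed_shift => //; exact: measurable_tnth.
  - by move=> t _; apply: prode_ge0.
rewrite big_ord_recl ge0_integralZr//.
- by rewrite (ge0_integral_signed_shift _ _ (f := g ord0)).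
- by apply: (measurableT_comp (mg _)); exact: measurable_signed_shift.
- by apply: prode_ge0 => l _; exact: integral_ge0.
Qed.

(** For fixed [h] the shear translates [x] by a constant; hence [x] is moved to the innermost
    position, translated there, and moved back. *)
Lemma ge0_integral_shear m (w : m.-tuple V -> V) (F : m.+1.-tuple V -> \bar R) :
  measurable_fun setT w -> measurable_fun setT F -> (forall v, 0 <= F v) ->
  \int[leb]_x \int[P m]_h F (cons_tuple (signed_shift false (w h) x) h) =
  \int[P m.+1]_v F v.
Proof.
move=> mw mF F0.
pose F' (v : m.+1.-tuple V) :=
  F (cons_tuple (signed_shift false (w [tuple of behead v]) (thead v) : V)
       [tuple of behead v]).
have E (x : V) (h : m.-tuple V) : F' (cons_tuple x h) =
    F (cons_tuple (signed_shift false (w h) x : V) h).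
  by rewrite /F' theadE; congr (F (cons_tuple (signed_shift _ (w _) _) _));
    exact/val_inj.
have mF' : measurable_fun setT F'.
  apply: (measurableT_comp mF); apply: measurable_cons.
    apply: measurable_signed_shift; last exact: measurable_tnth.
    by apply: (measurableT_comp mw); exact: measurable_behead.
  exact: measurable_behead.
transitivity (\int[P m.+1]_v F' v).
  rewrite ge0_integral_power_measureS//; last by move=> v; exact: F0.
  by apply: eq_integral => x _; apply: eq_integral => h _; rewrite E.
rewrite ge0_integral_power_measureS_swap//; last by move=> v; exact: F0.
rewrite ge0_integral_power_measureS_swap//.
apply: eq_integral => h _.
rewrite -(ge0_integral_signed_shift false (w h) (f := fun x => F (cons_tuple x h)))//.
  by apply: eq_integral => x _; rewrite E.
by apply: (measurableT_comp mF); exact: measurable_cons.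
Qed.
End gowers_integral.

Section gowers_corner.
Local Open Scope ereal_scope.
Context (R : realType) (n : nat).
Notation V := (n.-tuple (measurableTypeR R)).
Notation leb := (@borel_lebesgue_Rn R n).
Notation P m := (power_measure leb m).

Let zero : V := [tuple 0%R | i < n].

Lemma cube_shift_signed_shift k (a : k.-tuple bool) (x : V) (h : k.-tuple V) :
  cube_shift a x h = signed_shift false (cube_shift a zero h) x.
Proof.
by apply: eq_from_tnth => i; rewrite !tnth_mktuple add0r expr0 mul1r addrC.
Qed.

(** For fixed [h] the form is a translation in [x], so every slice of the preimage is a translate of
    [M] and is null. *)
Lemma cube_shift_null k (a : k.-tuple bool) (M : set V) :
  measurable M -> leb M = 0 ->
  P k.+1 ((fun v => cube_shift a (thead v) [tuple of behead v]) @^-1` M) = 0.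
Proof.
move=> mM M0; set L := fun v : k.+1.-tuple V => _.
have mL : measurable_fun [set: k.+1.-tuple V] (L : _ -> V).
  exact: measurable_cube_shift_tuple.
have mLM : measurable (L @^-1` M) by rewrite -[X in measurable X]setTI; exact: mL.
rewrite -[L @^-1` M]setIT -integral_indic//.
have mi : measurable_fun setT (fun x : V => (\1_M x)%:E : \bar R).
  by apply/measurable_EFinP; exact: measurable_indic.
rewrite ge0_integral_power_measureS_swap; last 2 first.
- by apply/measurable_EFinP; exact: measurable_indic.
- by move=> t; rewrite lee_fin.
rewrite -[RHS](integral0 (P k) setT); apply: eq_integral => h _.
transitivity (\int[leb]_x (\1_M (signed_shift false (cube_shift a zero h) x))%:E).
  apply: eq_integral => x _; congr (_%:E).
  rewrite !indicE; congr (_%:R); congr nat_of_bool.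
  rewrite -cube_shift_signed_shift.
  by apply/idP/idP => /set_mem H; apply/mem_set; move: H;
    rewrite /L /= theadE behead_cons_tuple.
rewrite (ge0_integral_signed_shift _ _ (f := fun x => (\1_M x)%:E))//.
by rewrite integral_indic// setIT; exact: M0.
Qed.

Section corner.
Variables (m : nat) (a b : m.+1.-tuple bool).
Hypothesis ab : tnth a ord0 != tnth b ord0.

(** This is [- a.h]. Shearing [x] by it turns the form of [a] into [x] itself and the form of
    [a + e_l] into [x + h_l] or [x - h_l]. *)
Let w (h : m.+1.-tuple V) : V := signed_shift true zero (cube_shift a zero h).

(** The part of the sheared form of [b] that is free of [h_0]; the coefficient of [h_0] is
    [b_0 - a_0], which is 1 or -1 because [a] and [b] differ there. *)
Let c (x : V) (h : m.-tuple V) : V :=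
  [tuple (tnth x i + \sum_(j < m) ((tnth b (lift ord0 j))%:R
    - (tnth a (lift ord0 j))%:R) * tnth (tnth h j) i)%R | i < n].

Let sum_natr (e : m.+1.-tuple bool) (F : 'I_m.+1 -> R) :
  (\sum_(j | tnth e j) F j = \sum_j (tnth e j)%:R * F j)%R.
Proof.
by rewrite big_mkcond; apply: eq_bigr => j _; case: (tnth e j); rewrite ?mul1r ?mul0r.
Qed.

Let shift_base x h : cube_shift a (signed_shift false (w h) x) h = x.
Proof.
apply: eq_from_tnth => i; rewrite !tnth_mktuple !add0r expr0 expr1 mul1r mulN1r.
by rewrite addrAC addNr add0r.
Qed.

Let shift_flip x h l :
  cube_shift (flip_coord a l) (signed_shift false (w h) x) h =
  signed_shift (tnth a l) x (tnth h l).
Proof.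
apply: eq_from_tnth => i; rewrite !tnth_mktuple !add0r expr0 expr1 mul1r mulN1r.
by rewrite sum_flip_coord; ring.
Qed.

Let shift_apex x h0 h :
  cube_shift b (signed_shift false (w (cons_tuple h0 h)) x) (cons_tuple h0 h) =
  signed_shift (tnth a ord0) (c x h) h0.
Proof.
apply: eq_from_tnth => i; rewrite !tnth_mktuple !add0r expr0 expr1 mul1r mulN1r.
rewrite !sum_natr !big_ord_recl.
under [in RHS]eq_bigr do rewrite mulrBl.
rewrite sumrB.
have E (e : m.+1.-tuple bool) : (\sum_(j < m) (tnth e (lift ord0 j))%:R *
    tnth (tnth (cons_tuple h0 h) (lift ord0 j)) i =
    \sum_(j < m) (tnth e (lift ord0 j))%:R * tnth (tnth h j) i)%R.
  by apply: eq_bigr => j _; rewrite tnth_cons_tupleS.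
rewrite !E !tnth0.
by move: ab; case: (tnth a ord0); case: (tnth b ord0) => //= _; ring.
Qed.

(** After the shear the forms are triangular: [h_0] occurs only in the factor of [b], each other
    [h_l] then only in the factor of [a + e_l], and [x] is left for the factor of [a]. Integrating
    in this order separates the product. *)
Lemma ge0_integral_corner (g : m.+1.-tuple bool -> V -> \bar R) :
  (forall e, measurable_fun [set: V] (g e)) -> (forall e x, 0 <= g e x) ->
  \int[P m.+2]_v (g a (cube_shift a (thead v) [tuple of behead v]) *
    (g b (cube_shift b (thead v) [tuple of behead v]) *
     \prod_(l < m) g (flip_coord a (lift ord0 l))
       (cube_shift (flip_coord a (lift ord0 l)) (thead v) [tuple of behead v]))) =
  \int[leb]_x g a x * (\int[leb]_x g b x *
    \prod_(l < m) \int[leb]_x g (flip_coord a (lift ord0 l)) x).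
Proof.
move=> mg g0.
have mgL e : measurable_fun [set: m.+2.-tuple V]
    (fun v => g e (cube_shift e (thead v) [tuple of behead v])).
  by apply: (measurableT_comp (mg e)); exact: measurable_cube_shift_tuple.
rewrite -(ge0_integral_shear (w := w)); last 3 first.
- apply: measurable_signed_shift => //; exact: measurable_cube_shift.
- apply: emeasurable_funM => //; apply: emeasurable_funM => //.
  exact: emeasurable_prod.
- by move=> v; rewrite !mule_ge0//; apply: prode_ge0.
have mc x : measurable_fun [set: m.-tuple V] (c x : _ -> V).
  apply/measurable_fun_tnthP => i.
  rewrite (_ : _ \o _ = fun h => tnth x i + \sum_(j < m)
    ((tnth b (lift ord0 j))%:R - (tnth a (lift ord0 j))%:R)
      * tnth (tnth h j) i)%R; last first.
    by apply/funext => h /=; rewrite tnth_mktuple.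
  apply: measurable_funD => //; apply: measurable_sum => j.
  apply: measurable_funM => //.
  exact: (measurableT_comp (measurable_tnth i) (measurable_tnth j)).
pose K := \int[leb]_x g b x * \prod_(l < m) \int[leb]_x g (flip_coord a (lift ord0 l)) x.
have K0 : 0 <= K.
  by rewrite mule_ge0 ?integral_ge0//; apply: prode_ge0 => l _; exact: integral_ge0.
pose H x (h : m.+1.-tuple V) :=
  g b (signed_shift (tnth a ord0) (c x [tuple of behead h]) (thead h)) *
  \prod_(l < m) g (flip_coord a (lift ord0 l))
    (signed_shift (tnth a (lift ord0 l)) x (tnth [tuple of behead h] l)).
have mH x : measurable_fun [set: m.+1.-tuple V] (H x).
  apply: emeasurable_funM.
    apply: (measurableT_comp (mg b)); apply: measurable_signed_shift.
      by apply: (measurableT_comp (mc x)); exact: measurable_behead.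
    exact: measurable_tnth.
  apply: emeasurable_prod => l; apply: (measurableT_comp (mg _)).
  apply: measurable_signed_shift => //.
  by apply: (measurableT_comp (measurable_tnth l)); exact: measurable_behead.
have H0 x h : 0 <= H x h by rewrite mule_ge0//; apply: prode_ge0.
transitivity (\int[leb]_x (g a x * K)); last by rewrite ge0_integralZr.
apply: eq_integral => x _.
transitivity (\int[P m.+1]_h (g a x * H x h)).
  apply: eq_integral => h _; rewrite theadE behead_cons_tuple shift_base.
  congr (_ * (_ * _)).
    case/tupleP: h => h0 h; rewrite -[[tuple of h0 :: h]]/(cons_tuple h0 h).
    by rewrite shift_apex theadE behead_cons_tuple.
  apply: eq_bigr => l _; rewrite shift_flip; congr (g _ (signed_shift _ _ _)).
  case/tupleP: h => h0 h; rewrite -[[tuple of h0 :: h]]/(cons_tuple h0 h).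
  by rewrite tnth_cons_tupleS behead_cons_tuple.
rewrite ge0_integralZl//; congr (_ * _).
(* [h_0] must be integrated first: the centre [c x h] depends on the other [h_l], and this
   integration removes that dependence. *)
rewrite ge0_integral_power_measureS_swap//.
pose Q (h : m.-tuple V) := \prod_(l < m) g (flip_coord a (lift ord0 l))
    (signed_shift (tnth a (lift ord0 l)) x (tnth h l)).
have mQ : measurable_fun setT Q.
  apply: emeasurable_prod => l; apply: (measurableT_comp (mg _)).
  by apply: measurable_signed_shift => //; exact: measurable_tnth.
transitivity (\int[P m]_h (\int[leb]_y g b y * Q h)).
  apply: eq_integral => h _.
  transitivity (\int[leb]_y (g b (signed_shift (tnth a ord0) (c x h) y) * Q h)).
    by apply: eq_integral => y _; rewrite /H theadE behead_cons_tuple.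
  rewrite ge0_integralZr//.
  - by congr (_ * _); exact: (ge0_integral_signed_shift _ _ (f := g b)).
  - by apply: (measurableT_comp (mg b)); exact: measurable_signed_shift.
  - by apply: prode_ge0.
rewrite ge0_integralZl//; last 2 first.
- by move=> h _; apply: prode_ge0.
- exact: integral_ge0.
congr (_ * _).
exact: (ge0_integral_prod_signed_shift x (fun l => tnth a (lift ord0 l))
  (g := fun l => g (flip_coord a (lift ord0 l)))).
Qed.

End corner.
End gowers_corner.

(** * Convex weights on corners *)

Section weights.
Context (R : realType) (m : nat).
Hypothesis m0 : (0 < m)%N.
Notation cube := (m.+1.-tuple bool).

Lemma flip_coordK (l : 'I_m.+1) : involutive (fun a : cube => flip_coord a l).
Proof.
by move=> a; apply: eq_from_tnth => i; rewrite !tnth_flip_coord -addbA addbb addbF.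
Qed.

(** Flipping coordinate 0 exchanges the two faces, so each holds half of the cube. *)
Lemma sum_face1 (c : bool) : \sum_(a : cube | tnth a ord0 == c) (1 : R) = 2 ^+ m.
Proof.
have E : \sum_(a : cube | tnth a ord0 == ~~ c) (1 : R) =
         \sum_(a : cube | tnth a ord0 == c) (1 : R).
  rewrite (reindex_inj (inv_inj (flip_coordK ord0))); apply: eq_bigl => a.
  by rewrite tnth_flip_coord eqxx addbT; case: (tnth a ord0); case: (c).
have : \sum_(a : cube) (1 : R) = 2 ^+ m.+1.
  by rewrite sumr_const card_tuple card_bool natrX.
rewrite (bigID (fun a : cube => tnth a ord0 == c))/=.
rewrite [X in _ + X](eq_bigl (fun a : cube => tnth a ord0 == ~~ c)); last first.
  by move=> a; case: (tnth a ord0); case: (c).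
rewrite E exprS; lra.
Qed.

Variable theta : cube -> R.
Hypothesis theta_sum : \sum_a theta a = m.+2%:R.

Definition face_sum (c : bool) : R := \sum_(a : cube | tnth a ord0 == c) theta a.

(** The weight [u b], given to every corner [(a, b)] with [a_0 <> b_0], solves
    [theta v = 2^m * u v + (m+1) * U (~~ v_0)], where [U c], the sum of [u] over
    the face [b_0 = c], is [face_weight c]. *)
Definition face_weight (c : bool) : R := (face_sum (~~ c) - 1) / (2 ^+ m * m%:R).

Definition corner_weight (b : cube) : R :=
  (theta b - m.+1%:R * face_weight (~~ tnth b ord0)) / 2 ^+ m.

Let two_gt0 : 0 < 2 ^+ m :> R. Proof. exact: exprn_gt0. Qed.
Let m_gt0 : 0 < m%:R :> R. Proof. by rewrite ltr0n. Qed.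

Lemma face_sumC c : face_sum c + face_sum (~~ c) = m.+2%:R.
Proof.
rewrite -theta_sum [RHS](bigID (fun a : cube => tnth a ord0 == c))/=; congr (_ + _).
by apply: eq_bigl => a; case: (tnth a ord0); case: (c).
Qed.

(** Consistency of the system for [u]. Summing it over the face [c] gives [face_sum c = 2^m * (U c +
    (m+1) * U (~~ c))]; with the total weight [2^m * (U c + U (~~ c)) = 1] this forces
    [U (~~ c) = (face_sum c - 1) / (2^m * m)], the formula of [face_weight]. *)
Lemma sum_corner_weight c :
  \sum_(b : cube | tnth b ord0 == c) corner_weight b = face_weight c.
Proof.
rewrite /corner_weight -mulr_suml sumrB.
rewrite [X in _ - X](eq_bigr (fun=> 1 * (m.+1%:R * face_weight (~~ c))))
  => [|b /eqP ->]; last first.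
  by rewrite mul1r.
rewrite -mulr_suml sum_face1 -/(face_sum c) /face_weight negbK.
have -> : face_sum c = m.+2%:R - face_sum (~~ c) by rewrite -(face_sumC c) addrK.
rewrite (_ : m.+2%:R = m%:R + 1 + 1); last by rewrite !natr1.
rewrite -[m.+1%:R]natr1; field.
by rewrite !gt_eqF.
Qed.

(** A vertex [v] is the [b] of [2^m] corners, each of weight [u v]. As [a], and as [a + e_l] for
    each of the [m] directions [l <> 0], it meets total weight [U (~~ v_0)], since these flips keep
    the face. The general [x] allows both [x = 1] (total weight) and [x = ln g] (AM-GM). *)
Lemma corner_decomposition (x : cube -> R) :
  \sum_v theta v * x v =
  \sum_(b : cube) \sum_(a : cube | tnth a ord0 != tnth b ord0)
    corner_weight b * (x a + (x b + \sum_(l < m) x (flip_coord a (lift ord0 l)))).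
Proof.
have S (y : cube -> R) :
    \sum_(b : cube) \sum_(a : cube | tnth a ord0 != tnth b ord0) corner_weight b * y a =
    \sum_a face_weight (~~ tnth a ord0) * y a.
  rewrite (exchange_big_dep predT)//=; apply: eq_bigr => a _.
  rewrite -mulr_suml -sum_corner_weight; congr (_ * _).
  by apply: eq_bigl => b; case: (tnth a ord0); case: (tnth b ord0).
under [RHS]eq_bigr do under eq_bigr do rewrite 2!mulrDr mulr_sumr.
under [RHS]eq_bigr do rewrite big_split big_split/=.
rewrite big_split big_split/= S.
have -> : \sum_(b : cube) \sum_(a : cube | tnth a ord0 != tnth b ord0)
    corner_weight b * x b = \sum_b 2 ^+ m * (corner_weight b * x b).
  apply: eq_bigr => b _; rewrite -(sum_face1 (~~ tnth b ord0)) mulr_suml.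
  under [RHS]eq_bigr do rewrite mul1r.
  by apply: eq_bigl => a; case: (tnth a ord0); case: (tnth b ord0).
have -> : \sum_(b : cube) \sum_(a : cube | tnth a ord0 != tnth b ord0)
    \sum_(l < m) corner_weight b * x (flip_coord a (lift ord0 l)) =
    m%:R * \sum_a face_weight (~~ tnth a ord0) * x a.
  under eq_bigr do rewrite exchange_big/=.
  rewrite exchange_big/= mulr_natl -[X in _ *+ X]card_ord -sumr_const.
  apply: eq_bigr => l _.
  rewrite (S (fun a => x (flip_coord a (lift ord0 l)))).
  rewrite (reindex_inj (inv_inj (flip_coordK (lift ord0 l)))).
  by apply: eq_bigr => a _; rewrite flip_coordK tnth_flip_coord addbF.
rewrite mulr_sumr -!big_split/=; apply: eq_bigr => v _.
rewrite /corner_weight -natr1; field.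
by rewrite gt_eqF.
Qed.

Lemma sum_corner_weight1 :
  \sum_(b : cube) \sum_(a : cube | tnth a ord0 != tnth b ord0) corner_weight b = 1.
Proof.
have := corner_decomposition (fun=> 1).
under eq_bigr do rewrite mulr1.
rewrite theta_sum sumr_const card_ord.
under [RHS]eq_bigr do rewrite -mulr_suml.
rewrite -mulr_suml => E.
have m2 : m.+2%:R != 0 :> R by rewrite pnatr_eq0.
apply: (mulIf m2); rewrite mul1r [RHS]E; congr (_ * _).
by rewrite -[m.+2%:R]nat1r -nat1r.
Qed.

Lemma corner_weight_ge0 :
  (forall v, `|theta v - m.+2%:R / 2 ^+ m.+1| <= (3 * 2 ^+ m.+1)^-1) ->
  forall b, 0 <= corner_weight b.
Proof.
move=> near b; apply: divr_ge0; last exact: ltW.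
rewrite subr_ge0 /face_weight negbK.
set c := tnth b ord0.
have hi v : theta v <= (m%:R + 7 / 3) / 2 ^+ m.+1.
  have := near v; rewrite ler_norml => /andP[_].
  rewrite (_ : m.+2%:R = m%:R + 1 + 1); last by rewrite !natr1.
  rewrite exprS => H.
  apply: (le_trans (y := (m%:R + 1 + 1) / (2 * 2 ^+ m) + (3 * (2 * 2 ^+ m))^-1)).
    by rewrite -lerBlDl.
  by rewrite le_eqVlt; apply/orP; left; apply/eqP; field; rewrite gt_eqF.
have lo : (m%:R + 5 / 3) / 2 ^+ m.+1 <= theta b.
  have := near b; rewrite ler_norml => /andP[+ _].
  rewrite (_ : m.+2%:R = m%:R + 1 + 1); last by rewrite !natr1.
  rewrite exprS => H.
  apply: (le_trans (y := (m%:R + 1 + 1) / (2 * 2 ^+ m) - (3 * (2 * 2 ^+ m))^-1)).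
    by rewrite le_eqVlt; apply/orP; left; apply/eqP; field; rewrite gt_eqF.
  by move: H; rewrite lerBrDr addrC.
apply: le_trans lo.
have F : face_sum c <= (m%:R + 7 / 3) / 2.
  apply: (@le_trans _ _ (\sum_(a : cube | tnth a ord0 == c) 1 * ((m%:R + 7 / 3) / 2 ^+ m.+1))).
    by apply: ler_sum => a _; rewrite mul1r.
  rewrite -mulr_suml sum_face1 exprS le_eqVlt; apply/orP; left; apply/eqP; field.
  by rewrite gt_eqF.
rewrite exprS -[m.+1%:R]natr1 mulrA ler_pdivrMr ?mulr_gt0//.
have -> : (m%:R + 5 / 3) / (2 * 2 ^+ m) * (2 ^+ m * m%:R) = (m%:R + 5 / 3) / 2 * m%:R :> R.
  by field; rewrite gt_eqF.
have m1 : 1 <= m%:R :> R by rewrite ler1n.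
apply: (@le_trans _ _ ((m%:R + 1) * ((m%:R + 7 / 3) / 2 - 1))).
  by apply: ler_wpM2l; [exact: addr_ge0|move: F; set x := face_sum c; lra].
(* The difference of the two sides is [(m - 1) / 6]: the tolerance [1/3] is exactly what the case
   [m = 1] allows. *)
nra.
Qed.

(** Jensen's inequality from the tangent line at the mean [c]: [expR y >= expR c * (1 + (y - c))],
    whose linear term averages to zero. *)
Lemma expR_convex_sum (I : finType) (u y : I -> R) :
  (forall i, 0 <= u i) -> \sum_i u i = 1 ->
  expR (\sum_i u i * y i) <= \sum_i u i * expR (y i).
Proof.
move=> u0 u1; set c := \sum_i u i * y i.
have -> : expR c = \sum_i u i * (expR c * (1 + (y i - c))).
  under eq_bigr do rewrite mulrCA.
  rewrite -mulr_sumr; under eq_bigr do rewrite mulrDr mulr1 mulrBr.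
  by rewrite big_split sumrB/= -mulr_suml u1 mul1r subrr addr0 mulr1.
apply: ler_sum => i _; rewrite ler_wpM2l//.
rewrite -[y i in leRHS](subrK c) [in leRHS]addrC expRD.
by rewrite ler_wpM2l ?expR_ge0// expR_ge1Dx.
Qed.

Lemma corner_amgm (g : cube -> R) :
  (forall v, 0 < theta v) -> (forall b, 0 <= corner_weight b) -> (forall v, 0 <= g v) ->
  \prod_v g v `^ theta v <=
  \sum_(b : cube) \sum_(a : cube | tnth a ord0 != tnth b ord0)
    corner_weight b * (g a * (g b * \prod_(l < m) g (flip_coord a (lift ord0 l)))).
Proof.
move=> theta0 u0 g0.
(* Logarithms need positive values. If some [g v] vanishes, so does the left side, because its
   exponent [theta v] is positive. *)
have [/existsP[v /eqP gv]|/existsPn gn] := boolP [exists v, g v == 0].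
  rewrite (bigD1 v)//= gv powR0 ?gt_eqF// mul0r.
  do 2 (apply: sumr_ge0 => ? _); apply: mulr_ge0; first exact: u0.
  by rewrite !mulr_ge0//; apply: prodr_ge0.
have gp v : 0 < g v by rewrite lt_neqAle g0 eq_sym gn.
have -> : \prod_v g v `^ theta v = expR (\sum_v theta v * ln (g v)).
  rewrite expR_sum; apply: eq_bigr => v _.
  by rewrite /powR gt_eqF.
rewrite corner_decomposition !pair_big_dep/=.
(* Weights extended by 0 to the pairs that are not corners, so that the sum runs over a whole finite
   type. *)
pose u (p : cube * cube) := if tnth p.2 ord0 != tnth p.1 ord0 then corner_weight p.1 else 0.
rewrite [X in expR X]big_mkcond [leRHS]big_mkcond/=.
pose y (p : cube * cube) := ln (g p.2) +
  (ln (g p.1) + \sum_(l < m) ln (g (flip_coord p.2 (lift ord0 l)))).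
rewrite (eq_bigr (fun p => u p * y p)); last first.
  by move=> p _; rewrite /u; case: ifP => //; rewrite mul0r.
rewrite [leRHS](eq_bigr (fun p => u p * expR (y p))); last first.
  move=> p _; rewrite /u; case: ifP => //; last by rewrite mul0r.
  move=> _; rewrite /y !expRD expR_sum !lnK ?posrE//; congr (_ * (_ * (_ * _))).
  by apply: eq_bigr => l _; rewrite lnK ?posrE.
apply: expR_convex_sum; first by move=> p; rewrite /u; case: ifP.
rewrite -sum_corner_weight1 pair_big_dep/= [RHS]big_mkcond; exact: eq_bigr.
Qed.

End weights.

(** Write [p] for the Gowers exponent and [r] for the radius. As [r <= p/2], one has [q >= p/2],
    hence [|1/q - 1/p| = |q - p| / (q p) <= 2 r / p^2], and [r] is chosen to make this
    [1 / (3 * 2^k)], the tolerance of [corner_weight_ge0]. *)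
Lemma inv_near_gowers_exponent (R : realType) (k : nat) (q : R) :
  `|q - gowers_exponent R k| <= 2 ^+ k / (6 * k.+1%:R ^+ 2) ->
  0 < q /\ `|q^-1 - k.+1%:R / 2 ^+ k| <= (3 * 2 ^+ k)^-1.
Proof.
rewrite /gowers_exponent; set T := 2 ^+ k; set K := k.+1%:R.
have T0 : 0 < T by exact: exprn_gt0.
have K1 : 1 <= K by rewrite ler1n.
have K0 : 0 < K by exact: lt_le_trans K1.
move=> H.
have r2 : T / (6 * K ^+ 2) <= T / K / 2.
  rewrite -mulrA ler_pM2l// -invfM lef_pV2 ?posrE ?mulr_gt0 ?exprn_gt0//.
  by rewrite expr2; nra.
have q2 : T / K / 2 <= q.
  move: H; rewrite ler_norml => /andP[H _].
  have -> : T / K / 2 = T / K - T / K / 2 by field; rewrite gt_eqF.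
  move: H r2; set x := T / K; set y := T / _; lra.
have p0 : 0 < T / K by rewrite divr_gt0.
have q0 : 0 < q by apply: lt_le_trans q2; rewrite divr_gt0.
split=> //.
have -> : q^-1 - K / T = - (q - T / K) * (q^-1 * (K / T)).
  by field; rewrite !gt_eqF.
rewrite normrM normrN (ger0_norm (x := q^-1 * _)); last first.
  by rewrite mulr_ge0 ?invr_ge0 ?divr_ge0 ?ltW.
have qi : q^-1 <= 2 * (K / T).
  rewrite -[leRHS]invrK lef_pV2 ?posrE ?invr_gt0 ?mulr_gt0 ?invr_gt0//.
  by rewrite invfM invf_div mulrC.
apply: (@le_trans _ _ (T / (6 * K ^+ 2) * (2 * (K / T) * (K / T)))).
  apply: ler_pM => //; first by rewrite mulr_ge0 ?invr_ge0 ?divr_ge0 ?ltW.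
  by rewrite ler_wpM2r// divr_ge0 ?ltW.
by rewrite le_eqVlt; apply/orP; left; apply/eqP; field; rewrite !gt_eqF.
Qed.

(** * The inequality for nonnegative functions *)

Section gowers_bound.
Local Open Scope ereal_scope.
Context (R : realType) (n m : nat).
Hypothesis m0 : (0 < m)%N.
Notation V := (n.-tuple (measurableTypeR R)).
Notation leb := (@borel_lebesgue_Rn R n).
Notation P := (power_measure leb m.+2).
Notation cV := (caratheodory_type (mu_ext leb)).
Notation cP := (caratheodory_type (mu_ext P)).
Notation cube := (m.+1.-tuple bool).
Notation L e v := (cube_shift e (thead v) [tuple of behead v]).

Lemma measurable_completed_cube_shift k (e : k.-tuple bool) :
  measurable_fun [set: caratheodory_type (mu_ext (power_measure leb k.+1))]
    ((fun v => L e v) : _ -> cV).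
Proof.
apply: measurable_completed_map; first exact: measurable_cube_shift_tuple.
exact: cube_shift_null.
Qed.

Lemma lee_prode (I : Type) (s : seq I) (f g : I -> \bar R) :
  (forall i, 0 <= f i) -> (forall i, f i <= g i) ->
  \prod_(i <- s) f i <= \prod_(i <- s) g i.
Proof.
move=> f0 fg; elim: s => [|i s IH]; first by rewrite !big_nil.
by rewrite !big_cons lee_pmul//; exact: prode_ge0.
Qed.

Lemma prode_le1 (I : Type) (s : seq I) (f : I -> \bar R) :
  (forall i, 0 <= f i) -> (forall i, f i <= 1) -> \prod_(i <- s) f i <= 1.
Proof.
move=> f0 f1; apply: (le_trans (lee_prode s f0 f1)).
by rewrite [leLHS]big1.
Qed.

Definition corner_product (g : cube -> n.-tuple R -> R) (a b : cube)
    (v : m.+2.-tuple (n.-tuple R)) : R :=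
  (g a (L a v) * (g b (L b v) * \prod_(l < m) g (flip_coord a (lift ord0 l))
     (L (flip_coord a (lift ord0 l)) v)))%R.

Lemma measurable_corner_product g a b :
  (forall e, measurable_fun [set: cV] (g e)) ->
  measurable_fun [set: cP] (corner_product g a b).
Proof.
move=> mg; have mgL e : measurable_fun [set: cP] (fun v => g e (L e v)).
  by apply: (measurableT_comp (mg e)); exact: measurable_completed_cube_shift.
apply: measurable_funM; first exact: mgL.
apply: measurable_funM; first exact: mgL.
by apply: measurable_prod => l _; exact: mgL.
Qed.

(** Majorants measurable for the original sigma-algebra, with the same integrals, reduce the bound
    to [ge0_integral_corner] on the uncompleted product. *)
Lemma ge0_integral_corner_product (g : cube -> n.-tuple R -> R) (a b : cube) :
  tnth a ord0 != tnth b ord0 ->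
  (forall e, measurable_fun [set: cV] (g e)) -> (forall e x, (0 <= g e x)%R) ->
  (forall e, \int[lebesgue_Rn R n]_x (g e x)%:E <= 1) ->
  \int[lebesgue_Rn_pow R n m.+2]_v (corner_product g a b v)%:E <= 1.
Proof.
move=> ab mg g0 g1.
have /choice[G HG] : forall e, exists G : V -> \bar R,
    [/\ measurable_fun [set: V] G, (forall x, (g e x)%:E <= G x) &
     \int[leb]_x G x <= 1].
  move=> e; have [G [mG gG IG]] := completed_majorant (mg e) (g0 e).
  by exists G; split => //; rewrite IG; exact: g1.
have mG e : measurable_fun [set: V] (G e) by have [] := HG e.
have gG e x : (g e x)%:E <= G e x by have [] := HG e.
have G1 e : \int[leb]_x G e x <= 1 by have [] := HG e.
have G0 e x : 0 <= G e x by rewrite (le_trans _ (gG e x))// lee_fin.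
pose H (v : m.+2.-tuple V) := G a (L a v) * (G b (L b v) *
  \prod_(l < m) G (flip_coord a (lift ord0 l)) (L (flip_coord a (lift ord0 l)) v)).
have mGL e : measurable_fun [set: m.+2.-tuple V] (fun v => G e (L e v)).
  by apply: (measurableT_comp (mG e)); exact: measurable_cube_shift_tuple.
have mH : measurable_fun [set: m.+2.-tuple V] H.
  by do 2 apply: emeasurable_funM => //; exact: emeasurable_prod.
have H0 v : 0 <= H v by rewrite !mule_ge0//; exact: prode_ge0.
apply: (@le_trans _ _ (\int[lebesgue_Rn_pow R n m.+2]_v H v)).
  apply: ge0_le_integral; first exact: measurableT.
  - move=> v _; rewrite lee_fin /corner_product !mulr_ge0//.
    exact: prodr_ge0.
  - by apply/measurable_EFinP; exact: measurable_corner_product.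
  - exact: measurable_fun_completed.
  move=> v _; rewrite /corner_product !EFinM -prodEFin.
  apply: lee_pmul => //.
  - by rewrite lee_fin.
  - by rewrite mule_ge0 ?lee_fin//; apply: prode_ge0 => l _; rewrite lee_fin.
  apply: lee_pmul => //.
  - by rewrite lee_fin.
  - by apply: prode_ge0 => l _; rewrite lee_fin.
  by apply: lee_prode => l; rewrite ?lee_fin.
rewrite [leLHS](ge0_integral_completed P mH H0) ge0_integral_corner//.
have I0 e : 0 <= \int[leb]_x G e x by exact: integral_ge0.
have M1 (x y : \bar R) : 0 <= x -> 0 <= y -> x <= 1 -> y <= 1 -> x * y <= 1.
  by move=> x0 y0 x1 y1; rewrite -[leRHS]mule1 lee_pmul.
apply: (M1) => //; first by rewrite mule_ge0//; exact: prode_ge0.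
by apply: M1 => //; [exact: prode_ge0|exact: prode_le1].
Qed.

Section weighted.
Variable theta : cube -> R.
Hypothesis theta_gt0 : forall v, (0 < theta v)%R.
Hypothesis theta_sum : (\sum_a theta a = m.+2%:R)%R.
Hypothesis u0 : forall b, (0 <= corner_weight theta b)%R.

(** Here [theta e] is [1/q_e] and [B e] a positive upper bound for the norm of [phi e]. Dividing by
    [B e] and raising to the power [q_e] gives a [g e] of integral at most 1 with
    [phi e = B e * g e ^ theta e], to which [corner_amgm] applies pointwise. *)
Lemma ge0_integral_gowers_product (phi : cube -> n.-tuple R -> R) (B : cube -> R) :
  (forall e, measurable_fun [set: cV] (phi e)) -> (forall e x, (0 <= phi e x)%R) ->
  (forall e, (0 < B e)%R) ->
  (forall e, \int[lebesgue_Rn R n]_x (phi e x `^ (theta e)^-1)%:E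
     <= (B e `^ (theta e)^-1)%:E) ->
  \int[lebesgue_Rn_pow R n m.+2]_v (\prod_e phi e (L e v))%:E <= (\prod_e B e)%:E.
Proof.
move=> mphi phi0 B0 phiB.
pose g e x := ((phi e x / B e) `^ (theta e)^-1)%R.
have mg e : measurable_fun [set: cV] (g e).
  apply: (measurableT_comp (measurable_powR _)).
  exact: measurable_funM.
have g0 e x : (0 <= g e x)%R by exact: powR_ge0.
have Binv e : (0 <= (B e)^-1)%R by rewrite invr_ge0 ltW.
have g1 e : \int[lebesgue_Rn R n]_x (g e x)%:E <= 1.
  have -> : \int[lebesgue_Rn R n]_x (g e x)%:E =
    \int[lebesgue_Rn R n]_x (((B e)^-1 `^ (theta e)^-1)%:E * (phi e x `^ (theta e)^-1)%:E).
    by apply: eq_integral => x _; rewrite /g mulrC powRM// EFinM.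
  rewrite ge0_integralZl_EFin; last 4 first.
  - exact: measurableT.
  - by move=> x _; rewrite lee_fin powR_ge0.
  - by apply/measurable_EFinP; exact: (measurableT_comp (measurable_powR _)).
  - exact: powR_ge0.
  apply: (@le_trans _ _ (((B e)^-1 `^ (theta e)^-1)%:E * (B e `^ (theta e)^-1)%:E)).
    by rewrite lee_pmul2l// lte_fin powR_gt0// invr_gt0.
  by rewrite -EFinM -powRM ?(ltW (B0 e))// mulVf ?gt_eqF// powR1.
have phiE e x : phi e x = (B e * g e x `^ theta e)%R.
  rewrite /g -powRrM mulVf ?gt_eqF// powRr1; last by rewrite mulr_ge0.
  by rewrite mulrC divfK// gt_eqF.
pose W v := (\sum_(b : cube) \sum_(a : cube | tnth a ord0 != tnth b ord0)
    corner_weight theta b * corner_product g a b v)%R.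
have prodB0 : (0 <= \prod_e B e)%R by apply: prodr_ge0 => e _; exact: ltW.
have C0 p v : (0 <= corner_weight theta p.1 * corner_product g p.2 p.1 v)%R.
  apply: mulr_ge0; first exact: u0.
  by rewrite !mulr_ge0//; exact: prodr_ge0.
have mC p : measurable_fun [set: cP]
    (fun v => corner_weight theta p.1 * corner_product g p.2 p.1 v)%R.
  apply: measurable_funM; first exact: measurable_cst.
  exact: measurable_corner_product.
pose s := [seq p <- index_enum (cube * cube)%type | tnth p.2 ord0 != tnth p.1 ord0].
have WE v : W v = (\sum_(p <- s) corner_weight theta p.1 * corner_product g p.2 p.1 v)%R.
  by rewrite /W pair_big_dep/= big_filter.
have mW : measurable_fun [set: cP] W.
  rewrite (_ : W = fun v =>
      \sum_(p <- s) corner_weight theta p.1 * corner_product g p.2 p.1 v)%R.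
    exact: measurable_sum.
  by apply/funext => v; exact: WE.
have W0 v : (0 <= W v)%R by rewrite WE sumr_ge0.
have IW : \int[lebesgue_Rn_pow R n m.+2]_v (W v)%:E <= 1.
  under eq_integral do rewrite WE -sumEFin.
  rewrite ge0_integral_sum; last 3 first.
  - exact: measurableT.
  - by move=> p; apply/measurable_EFinP; exact: mC.
  - by move=> p v _; rewrite lee_fin.
  have -> : 1 = \sum_(p <- s) (corner_weight theta p.1)%:E.
    by rewrite sumEFin big_filter -(sum_corner_weight1 m0 theta_sum) pair_big_dep.
  rewrite [leLHS]big_filter [leRHS]big_filter.
  apply: lee_sum => -[b a]/= ab.
  under eq_integral do rewrite EFinM.
  rewrite ge0_integralZl_EFin; last 4 first.
  - exact: measurableT.
  - by move=> v _; rewrite lee_fin !mulr_ge0//; exact: prodr_ge0.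
  - by apply/measurable_EFinP; exact: measurable_corner_product.
  - exact: u0.
  rewrite -[leRHS]mule1 lee_wpmul2l ?lee_fin//.
  exact: ge0_integral_corner_product.
apply: (@le_trans _ _ (\int[lebesgue_Rn_pow R n m.+2]_v ((\prod_e B e)%:E * (W v)%:E))).
  apply: ge0_le_integral; first exact: measurableT.
  - by move=> v _; rewrite lee_fin prodr_ge0.
  - apply/measurable_EFinP; apply: measurable_prod => e _.
    by apply: (measurableT_comp (mphi e)); exact: measurable_completed_cube_shift.
  - apply/measurable_EFinP; apply: measurable_funM; first exact: measurable_cst.
    exact: mW.
  move=> v _; rewrite -EFinM lee_fin.
  under eq_bigr do rewrite phiE.
  rewrite big_split/= ler_wpM2l//.
  exact: (corner_amgm m0 theta_sum (g := fun e => g e (L e v))).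
rewrite ge0_integralZl_EFin; last 4 first.
- exact: measurableT.
- by move=> v _; rewrite lee_fin; exact: W0.
- exact/measurable_EFinP.
- exact: prodB0.
by rewrite -[leRHS]mule1 lee_wpmul2l ?lee_fin.
Qed.
End weighted.
End gowers_bound.

(** * Complex-valued integrands and the final estimate *)

Section complex_functions.
Context d (T : measurableType d) (R : realType).
Implicit Types (mu : {measure set T -> \bar R}) (f : T -> R[i]).

Lemma cmeasurable_prod mu (I : Type) (s : seq I) (f : I -> T -> R[i]) :
  (forall i, cmeasurable mu (f i)) -> cmeasurable mu (fun x => \prod_(i <- s) f i x).
Proof.
move=> mf; elim: s => [|i s [IHr IHi]].
  by split; under eq_fun do rewrite big_nil; exact: measurable_cst.
have [mr mi] := mf i; split.
  rewrite (_ : (fun _ => _) = fun x => complex.Re (f i x) * complex.Re (\prod_(j <- s) f j x)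
    - complex.Im (f i x) * complex.Im (\prod_(j <- s) f j x)).
    by apply: measurable_funB; exact: measurable_funM.
  by apply/funext => x; rewrite big_cons; case: (f i x) => ? ?; case: (\prod_(_ <- _) _).
rewrite (_ : (fun _ => _) = fun x => complex.Re (f i x) * complex.Im (\prod_(j <- s) f j x)
    + complex.Im (f i x) * complex.Re (\prod_(j <- s) f j x)).
  by apply: measurable_funD; exact: measurable_funM.
by apply/funext => x; rewrite big_cons; case: (f i x) => ? ?; case: (\prod_(_ <- _) _).
Qed.

Lemma measurable_normc mu f : cmeasurable mu f ->
  measurable_fun [set: T] (fun x => Normc.normc (f x)).
Proof.
move=> [mr mi].
rewrite (_ : (fun _ => _) = fun x => Num.sqrt (complex.Re (f x) ^+ 2 + complex.Im (f x) ^+ 2)).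
  apply: (measurableT_comp (continuous_measurable_fun (@sqrt_continuous R))).
  by apply: measurable_funD; exact: measurable_funX.
by apply/funext => x; case: (f x).
Qed.

Lemma normc_Re_Im (z : R[i]) :
  [/\ `|complex.Re z| <= Normc.normc z, `|complex.Im z| <= Normc.normc z &
   Normc.normc z <= `|complex.Re z| + `|complex.Im z| ].
Proof.
case: z => a b /=; split.
- by rewrite -sqrtr_sqr ler_sqrt ?lerDl ?addr_ge0 ?sqr_ge0.
- by rewrite -sqrtr_sqr ler_sqrt ?lerDr ?addr_ge0 ?sqr_ge0.
rewrite -(ler_pXn2r (n := 2)) ?nnegrE ?sqrtr_ge0 ?addr_ge0//.
rewrite sqr_sqrtr ?addr_ge0 ?sqr_ge0// sqrrD !real_normK ?num_real//.
by rewrite lerD2r lerDl mulrn_wge0 ?mulr_ge0.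
Qed.

(* The factor 2 comes from bounding real and imaginary parts separately. *)
Lemma cintegral_le mu f (M : R) : cmeasurable mu f ->
  (\int[mu]_x (Normc.normc (f x))%:E <= M%:E)%E ->
  cintegrable mu f /\ Normc.normc (cintegral mu f) <= 2 * M.
Proof.
move=> mf fM; have mn := measurable_normc mf; have [mr mi] := mf.
have H (h : T -> R) : measurable_fun [set: T] h ->
    (forall x, `|h x| <= Normc.normc (f x)) ->
    mu.-integrable [set: T] (EFin \o h) /\ `|\int[mu]_x h x| <= M.
  move=> mh hf.
  have I : (\int[mu]_x `|(EFin \o h) x| <= M%:E)%E.
    apply: le_trans fM; apply: ge0_le_integral => //.
    - by apply: measurableT_comp => //; exact/measurable_EFinP.
    - exact/measurable_EFinP.
    - by move=> x _; rewrite /= lee_fin.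
  have ih : mu.-integrable [set: T] (EFin \o h).
    apply/integrableP; split; first exact/measurable_EFinP.
    by rewrite (le_lt_trans I)// ltry.
  split=> //.
  apply: (le_trans (le_normr_Rintegral measurableT ih)).
  rewrite /Rintegral -lee_fin fineK//.
  by rewrite ge0_fin_numE ?integral_ge0// (le_lt_trans I)// ltry.
have [ir rM] := H _ mr (fun x => let: And3 a _ _ := normc_Re_Im (f x) in a).
have [ii iM] := H _ mi (fun x => let: And3 _ b _ := normc_Re_Im (f x) in b).
split=> //; have [_ _ /le_trans] := normc_Re_Im (cintegral mu f); apply.
by rewrite mulr_natl mulr2n lerD.
Qed.

End complex_functions.

(** This permits normalisation by positive bounds when a norm may be zero: a vanishing factor is
    approached from above while the others stay bounded. *)
Lemma lee_prod_majorants (R : realType) (I : finType) (N : I -> R) (X : \bar R) :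
  (forall i, 0 <= N i) ->
  (forall B : I -> R, (forall i, 0 < B i) -> (forall i, N i <= B i) ->
     (X <= (\prod_i B i)%:E)%E) ->
  (X <= (\prod_i N i)%:E)%E.
Proof.
move=> N0 H.
have [/existsP[i0 /eqP Ni]|/existsPn gn] := boolP [exists i, N i == 0]; last first.
  by apply: H => // i; rewrite lt_neqAle N0 eq_sym gn.
rewrite (bigD1 i0)//= Ni mul0r.
pose K := \prod_(i | i != i0) (N i + 1).
have K0 : 0 < K by apply: prodr_gt0 => i _; rewrite ltr_wpDl.
apply/lee_addgt0Pr => e e0; rewrite add0e.
have eK : 0 < e / K by rewrite divr_gt0.
(* With this choice the product of the bounds is exactly [e]; the added 1 keeps the other factors
   positive. *)
have := H (fun i => if i == i0 then e / K else N i + 1).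
rewrite (bigD1 i0)//= eqxx.
rewrite (eq_bigr (fun i => N i + 1)); last by move=> i /negbTE ->.
rewrite divfK ?gt_eqF//; apply => i; case: eqP => [ii|_] //.
- by rewrite ltr_wpDl.
- by rewrite ii Ni ltW.
- by rewrite lerDl.
Qed.

Lemma cmeasurable_gowers_integrand (R : realType) k n
    (f : k.-tuple bool -> n.-tuple R -> R[i]) :
  (forall a, cmeasurable (lebesgue_Rn R n) (f a)) ->
  cmeasurable (lebesgue_Rn_pow R n k.+1) (gowers_integrand f).
Proof.
move=> mf; apply: cmeasurable_prod => a.
have [mr mi] := mf a; have mL := @measurable_completed_cube_shift R n k a.
have mr' := measurableT_comp mr mL; have mi' := measurableT_comp mi mL.
rewrite /conj_parity; case: odd; last by split; [exact: mr'|exact: mi'].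
split.
  rewrite (_ : (fun _ => _) = (fun x => complex.Re (f a x)) \o
    (fun v => cube_shift a (thead v) [tuple of behead v])); first exact: mr'.
  by apply/funext => v /=; case: (f a _).
rewrite (_ : (fun _ => _) = -%R \o ((fun x => complex.Im (f a x)) \o
  (fun v => cube_shift a (thead v) [tuple of behead v]))).
  by apply: measurableT_comp; [exact: oppr_measurable|exact: mi'].
by apply/funext => v /=; case: (f a _).
Qed.

Lemma normc_gowers_integrand (R : realType) k n
    (f : k.-tuple bool -> n.-tuple R -> R[i]) v :
  Normc.normc (gowers_integrand f v) =
  \prod_a Normc.normc (f a (cube_shift a (thead v) [tuple of behead v])).
Proof.
rewrite /gowers_integrand (big_morph _ (@Normc.normcM R) (@Normc.normc1 R)).
apply: eq_bigr => a _; rewrite /conj_parity; case: odd => //.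
by case: (f a _) => x y /=; rewrite sqrrN.
Qed.

Theorem mainTheorem3 (R : realType) (k : nat) (hk : (2 <= k)%N) :
  exists r : R, 0 < r /\
  forall n : nat, (1 <= n)%N ->
  exists C : R,
  forall q : k.-tuple bool -> R,
    (forall a, `|q a - gowers_exponent R k| <= r) ->
    \sum_(a : k.-tuple bool) (q a)^-1 = k.+1%:R ->
  forall f : k.-tuple bool -> n.-tuple R -> R[i],
    (forall a, cmeasurable (lebesgue_Rn R n) (f a)) ->
    (forall a, (cLnorm (lebesgue_Rn R n) (q a) (f a) < +oo)%E) ->
    cintegrable (lebesgue_Rn_pow R n k.+1) (gowers_integrand f) /\
    Normc.normc (gowers_form f) <=
      C * \prod_(a : k.-tuple bool) fine (cLnorm (lebesgue_Rn R n) (q a) (f a)).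
Proof.
case: k hk => [//|m] m0.
exists (2 ^+ m.+1 / (6 * m.+2%:R ^+ 2)); split.
  by rewrite divr_gt0 ?mulr_gt0 ?exprn_gt0.
move=> n _; exists 2 => q q_near q_sum f mf fLq.
have q0 a : 0 < q a by have [] := inv_near_gowers_exponent (q_near a).
have u0 b : 0 <= corner_weight (fun a => (q a)^-1) b.
  apply: corner_weight_ge0 => // a.
  by have [] := inv_near_gowers_exponent (q_near a).
have theta0 a : 0 < (q a)^-1 by rewrite invr_gt0.
set N := fun a => fine (cLnorm (lebesgue_Rn R n) (q a) (f a)).
have N0 a : 0 <= N a by rewrite fine_ge0// Lnorm_ge0.
apply: cintegral_le; first exact: cmeasurable_gowers_integrand.
apply: lee_prod_majorants => // B B0 NB.
under eq_integral do rewrite normc_gowers_integrand.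
apply: (ge0_integral_gowers_product m0 theta0 q_sum u0
  (phi := fun a x => Normc.normc (f a x))).
- by move=> e; exact: measurable_normc (mf e).
- by move=> e x; case: (f e x) => ? ?; exact: sqrtr_ge0.
- exact: B0.
(* The inverse of [theta e] is [q e], so the integral is the [q e]-th power of the norm, and
   monotonicity of powers finishes. *)
move=> e; rewrite invrK.
have nq : (cLnorm (lebesgue_Rn R n) (q e) (f e) `^ q e =
  \int[lebesgue_Rn R n]_x (Normc.normc (f e x) `^ q e)%:E)%E.
  rewrite /cLnorm poweR_Lnorm; last by rewrite gt_eqF.
  apply: eq_integral => x _.
  rewrite /= ger0_norm ?poweR_EFin//.
  by case: (f e x) => ? ?; exact: sqrtr_ge0.
rewrite -nq -[cLnorm _ _ _]fineK; last first.
  by rewrite ge0_fin_numE ?Lnorm_ge0.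
rewrite poweR_EFin lee_fin; apply: ge0_ler_powR; rewrite ?nnegrE; last exact: NB.
- exact: ltW.
- exact: N0.
- exact: ltW.
Qed.
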